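(* A principal contact element net $(m,s):\mathbb{Z}^2\to\mathbb{R}^3\times S^2$ is minimal if and only if the net $s:\mathbb{Z}^2\to S^2$ is (discrete) isothermic and $m=s^*$ is its Christoffel dual.
   Context: $\mathbb{Z}^2$ carries its regular quad combinatorics (elementary edges, elementary quadrilaterals as faces). A Q-net is a map $m:\mathbb{Z}^2\to\mathbb{R}^3$ all of whose elementary quadrilaterals are planar; it is circular if the vertices of each elementary quadrilateral lie on a circle. Two nets $m,s$ are parallel if for each elementary edge $(n,n')$ the vectors $m(n)-m(n')$ and $s(n)-s(n')$ are linearly dependent. A contact element net is a pair $(m,s):\mathbb{Z}^2\to\mathbb{R}^3\times S^2$, identified with the points $m$ together with the oriented planes through them orthogonal to $s$; it is principal if for every elementary edge $(n,n')$ there is $t\in\mathbb{R}$ with $(m+ts)(n)=(m+ts)(n')$. Principal contact element nets considered here are polyhedral: $m$ is a circular Q-net with parallel unit Gauss map $s$, the nets have no zero edges, and faces of $m$ have nonvanishing area; corresponding faces $m(f)$, $s(f)$ lie in parallel planes. In a 2-dimensional space, $A(P)=\frac12\sum_i\det(p_i,p_{i+1})$ is the oriented area of a polygon $P$ (indices cyclic), and $A(P,Q)$ is the associated symmetric bilinear form (mixed area), also applied to polygons in parallel planes. The mean curvature of the face $f$ of $(m,s)$ is $H_f=-A(m(f),s(f))/A(m(f))$, and $(m,s)$ is minimal if $H_f=0$ for all faces. Polyhedral nets $m,m'$ are Christoffel dual, $m'=m^*$, if they are parallel and $A(m(f),m'(f))=0$ for all faces $f$. A Koenigs net is a polyhedral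 net possessing a Christoffel dual. A net is discrete isothermic if it is a circular Koenigs net. *)

(* Defs.v *)
From HB Require Import structures.
From mathcomp Require Import all_boot all_order all_algebra.
From mathcomp Require Import reals.

Set Implicit Arguments.
Unset Strict Implicit.
Unset Printing Implicit Defensive.

Import Order.TTheory GRing.Theory Num.Theory.
Local Open Scope ring_scope.

Section Defs.
Variable R : realType.

Definition point := 'rV[R]_3.
Definition net := int * int -> point.

Definition dot (u v : point) : R := \sum_(k < 3) u 0 k * v 0 k.

Definition det3 (u v w : point) : R :=
  \det (\matrix_(i < 3) nth 0 [:: u; v; w] i).

(* Each elementary edge of Z^2 is listed with one of its two orientations; all
   conditions on edges below are insensitive to the orientation. *)
Definition edge (a b : int * int) : Prop := b = a + (1, 0) \/ b = a + (0, 1).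

(* The elementary quadrilateral whose lower left corner is f, with its vertices
   in cyclic order. *)
Definition face (m : net) (f : int * int) : 'I_4 -> point :=
  fun k => nth 0 [:: m f; m (f + (1, 0)); m (f + (1, 1)); m (f + (0, 1))] k.

Definition unit_normal (n : nat) (nu : point) (P : 'I_n -> point) : Prop :=
  dot nu nu = 1 /\ exists c : R, forall k, dot nu (P k) = c.

Definition planar (n : nat) (P : 'I_n -> point) : Prop :=
  exists nu, unit_normal nu P.

Definition parallel_planes (n : nat) (P Q : 'I_n -> point) : Prop :=
  exists nu, unit_normal nu P /\ unit_normal nu Q.

Definition concyclic (n : nat) (P : 'I_n -> point) : Prop :=
  exists (c nu : point) (r : R),
    [/\ 0 < r, dot nu nu = 1 &
        forall k, dot nu (P k - c) = 0 /\ dot (P k - c) (P k - c) = r ^+ 2].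

Definition Q_net (m : net) : Prop := forall f, planar (face m f).

Definition no_zero_edges (m : net) : Prop := forall a b, edge a b -> m a != m b.

(* Zero edges must be excluded here: otherwise a constant net would be a
   Christoffel dual of every net. *)
Definition polyhedral (m : net) : Prop := Q_net m /\ no_zero_edges m.

Definition circular (m : net) : Prop :=
  Q_net m /\ forall f, concyclic (face m f).

Definition parallel (m s : net) : Prop :=
  forall a b, edge a b -> ~~ free [:: m a - m b; s a - s b].

(* Mixed area of polygons in planes with unit normal nu. On the linear plane
   orthogonal to nu, (u, v) |-> det3 u v nu is the determinant with respect to
   any orthonormal basis (b1, b2) such that (b1, b2, nu) is positively
   oriented. Components along nu do not contribute, so translating the polygons
   into the linear plane is not needed. Replacing nu by - nu reverses the
   orientation, hence the sign. ordS is the cyclic successor. *)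
Definition mixed_area (n : nat) (nu : point) (P Q : 'I_n -> point) : R :=
  4^-1 * \sum_(k < n) (det3 (P k) (Q (ordS k)) nu + det3 (Q k) (P (ordS k)) nu).

Definition area (n : nat) (nu : point) (P : 'I_n -> point) : R :=
  2^-1 * \sum_(k < n) det3 (P k) (P (ordS k)) nu.

(* A quotient of two areas, hence independent of the choice between nu and
   - nu. *)
Definition mean_curvature (m s : net) (f : int * int) (nu : point) : R :=
  - mixed_area nu (face m f) (face s f) / area nu (face m f).

Definition contact_element_net (m s : net) : Prop :=
  forall a, dot (s a) (s a) = 1.

Definition principal (m s : net) : Prop :=
  forall a b, edge a b -> exists t : R, m a + t *: s a = m b + t *: s b.

(* Regularity of the principal contact element nets under consideration. *)
Definition polyhedral_contact (m s : net) : Prop :=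
  [/\ circular m, parallel m s, no_zero_edges m /\ no_zero_edges s,
      forall f, exists2 nu, unit_normal nu (face m f) & area nu (face m f) != 0
    & forall f, parallel_planes (face m f) (face s f)].

(* nu is unique up to sign, since the faces of m have nonvanishing area. *)
Definition minimal (m s : net) : Prop :=
  forall f, exists nu, [/\ unit_normal nu (face m f), unit_normal nu (face s f)
                         & mean_curvature m s f nu = 0].

(* A common normal nu exists for any two parallel polyhedral nets, and the
   vanishing of the mixed area does not depend on its choice. *)
Definition christoffel_dual (m m' : net) : Prop :=
  [/\ polyhedral m, polyhedral m', parallel m m' &
      forall f, exists nu, [/\ unit_normal nu (face m f),
                               unit_normal nu (face m' f)
                             & mixed_area nu (face m f) (face m' f) = 0]].

Definition koenigs (m : net) : Prop :=
  polyhedral m /\ exists m' : net, christoffel_dual m m'.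

Definition isothermic (m : net) : Prop := circular m /\ koenigs m.

Lemma mixed_areaPP (n : nat) (nu : point) (P : 'I_n -> point) :
  mixed_area nu P P = area nu P.
Proof.
rewrite /mixed_area /area big_split /= -mulr2n -[X in _ * X]mulr_natl mulrA.
congr (_ * _).
by rewrite -[4]/((2 * 2)%:R) natrM invfM -mulrA mulVf ?mulr1 // pnatr_eq0.
Qed.

End Defs.

(* Main.v *)
Require Import Defs.
From mathcomp Require Import all_boot all_order all_algebra.
From mathcomp Require Import reals.
From mathcomp Require Import ring.

(** The condition [H_f = 0] says that the mixed area [A(m(f), s(f))] vanishes,
    which, the mixed area being symmetric, is the condition for [m] to be
    Christoffel dual to [s]; the other requirements of duality are regularity
    properties of the pair [(m, s)]. Two points remain.

    - The mean curvature is a quotient, so its vanishing gives that of the mixed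
      area only if the area of [m(f)] is nonzero with respect to the same normal.
      Nondegeneracy is known for some unit normal of [m(f)], and it carries over
      to every other one: the area of a planar quadrilateral is half of
      [det3 d d' nu], where [d] and [d'] are the diagonals, and the cross product
      of [d] and [d'] is a multiple of any unit normal ([quad_areaE],
      [det3_change_normal], [quad_area_neq0]).

    - Isothermic nets are circular by definition. A planar face of [s] lies on
      the unit sphere, hence on a circle, whose radius is positive because the
      face has distinct vertices ([spherical_concyclic]). *)

Set Implicit Arguments.
Unset Strict Implicit.
Unset Printing Implicit Defensive.

Import Order.TTheory GRing.Theory Num.Theory.
Local Open Scope ring_scope.

Section Products.
Variable R : realType.
Implicit Types (u v w nu : point R).

(** Reading coordinates by their rank identifies equal ordinals built in
    different ways. *)
Lemma coord_nat : exists c : point R -> nat -> R, forall u i, u 0 i = c u i.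
Proof. by exists (fun u k => u 0 (inord k)) => u i; rewrite inord_val. Qed.

Lemma dotE u v :
  dot u v = u 0 0 * v 0 0 + u 0 1 * v 0 1 + u 0 ord_max * v 0 ord_max.
Proof.
have [c cE] := coord_nat.
by rewrite /dot !big_ord_recl big_ord0 !cE addr0 addrA.
Qed.

Lemma det3E u v w :
  det3 u v w = u 0 0 * (v 0 1 * w 0 ord_max - v 0 ord_max * w 0 1)
             - u 0 1 * (v 0 0 * w 0 ord_max - v 0 ord_max * w 0 0)
             + u 0 ord_max * (v 0 0 * w 0 1 - v 0 1 * w 0 0).
Proof.
have [c cE] := coord_nat.
rewrite /det3 (expand_det_row _ 0) !big_ord_recl big_ord0 /cofactor.
rewrite !(expand_det_row _ 0) !big_ord_recl !big_ord0 /cofactor !det_mx11.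
by rewrite !mxE /= !cE /bump /=; ring.
Qed.

Lemma dotBr u v w : dot u (v - w) = dot u v - dot u w.
Proof. by rewrite !dotE !mxE; ring. Qed.

Lemma dotZr a u v : dot u (a *: v) = a * dot u v.
Proof. by rewrite !dotE !mxE; ring. Qed.

Lemma dotC u v : dot u v = dot v u.
Proof. by rewrite !dotE; ring. Qed.

Lemma dot_ge0 u : 0 <= dot u u.
Proof. by apply: sumr_ge0 => k _; rewrite -expr2 sqr_ge0. Qed.

Lemma dot_eq0 u : dot u u = 0 -> u = 0.
Proof.
move/eqP; rewrite psumr_eq0 => [/allP u0|k _]; last by rewrite -expr2 sqr_ge0.
apply/rowP => k; apply/eqP; have := u0 k (mem_index_enum _).
by rewrite mxE mulf_eq0 orbb.
Qed.

(** The cross product of [u] and [v] is [det3 u v nu *: nu]; this is its scalar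
    product with [w]. *)
Lemma det3_change_normal u v nu w :
    dot nu nu = 1 -> dot nu u = 0 -> dot nu v = 0 ->
  det3 u v w = dot nu w * det3 u v nu.
Proof.
move=> nu1 u0 v0.
(* Lagrange's identity for the cross product of nu with that of u and v. *)
have: dot nu nu * det3 u v w - dot nu w * det3 u v nu
    = dot nu v * det3 u nu w - dot nu u * det3 v nu w.
  by rewrite !dotE !det3E; ring.
by rewrite nu1 u0 v0 mul1r !mul0r subrr => /eqP; rewrite subr_eq0 => /eqP.
Qed.

End Products.

Section Areas.
Variable R : realType.

(** The diagonals are translation invariant, so a normal enters only through
    its orthogonality to differences of vertices. *)
Lemma quad_areaE (nu : point R) (P : 'I_4 -> point R) :
  area nu P
  = 2^-1 * det3 (P (inord 2) - P (inord 0)) (P (inord 3) - P (inord 1)) nu.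
Proof.
rewrite /area; congr (_ * _).
have -> : \sum_(k < 4) det3 (P k) (P (ordS k)) nu
        = \sum_(k < 4) det3 (P (inord k)) (P (inord (k.+1 %% 4))) nu.
  apply: eq_bigr => k _; rewrite inord_val; congr (det3 _ (P _) _).
  by apply/val_inj; rewrite /= inordK // ltn_mod.
by rewrite !big_ord_recr big_ord0 /= !det3E !mxE; ring.
Qed.

(** Both diagonals are orthogonal to [nu], so by [det3_change_normal] the area
    for [nu'] is [dot nu nu'] times the area for [nu]. *)
Lemma quad_area_neq0 (nu nu' : point R) (P : 'I_4 -> point R) :
  unit_normal nu P -> area nu' P != 0 -> area nu P != 0.
Proof.
move=> [nu1 [c nuP]]; rewrite !quad_areaE.
rewrite (det3_change_normal nu' nu1) ?dotBr ?nuP ?subrr //.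
by rewrite mulrCA mulf_eq0 => /norP[].
Qed.

Lemma mixed_areaC n (nu : point R) (P Q : 'I_n -> point R) :
  mixed_area nu P Q = mixed_area nu Q P.
Proof. by congr (_ * _); apply: eq_bigr => k _; rewrite addrC. Qed.

Lemma mean_curvature0_mixed_area (m s : net R) f (nu : point R) :
    area nu (face m f) != 0 ->
  mean_curvature m s f nu = 0 -> mixed_area nu (face m f) (face s f) = 0.
Proof.
move=> A0 /eqP; rewrite mulf_eq0 invr_eq0 (negPf A0) orbF oppr_eq0.
by move/eqP.
Qed.

End Areas.

Section Spherical.
Variable R : realType.

(** The plane [dot nu x = c] meets the unit sphere in the circle with centre
    [c *: nu] and squared radius [1 - c ^+ 2]. *)
Lemma spherical_concyclic n (P : 'I_n -> point R) i j :
  (forall k, dot (P k) (P k) = 1) -> planar P -> P i != P j -> concyclic P.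
Proof.
move=> P1 [nu [nu1 [c nuP]]] neqP.
have normP k : dot (P k - c *: nu) (P k - c *: nu) = 1 - c ^+ 2.
  rewrite dotBr dotZr ![dot (_ - _) _]dotC !dotBr !dotZr nu1 P1 nuP.
  by rewrite dotC nuP; ring.
have r_gt0 : 0 < 1 - c ^+ 2.
  rewrite lt_neqAle -{2}(normP i) dot_ge0 andbT eq_sym.
  apply: contra neqP => /eqP r0.
  have Pc k : P k = c *: nu.
    by apply/eqP; rewrite -subr_eq0; apply/eqP/dot_eq0; rewrite normP.
  by rewrite !Pc.
exists (c *: nu), nu, (Num.sqrt (1 - c ^+ 2)); split=> [||k] //.
  by rewrite sqrtr_gt0.
by rewrite normP sqr_sqrtr ?ltW // dotBr dotZr nuP nu1 mulr1 subrr.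
Qed.

Lemma spherical_circular (s : net R) :
    (forall a, dot (s a) (s a) = 1) -> polyhedral s -> circular s.
Proof.
move=> s1 [sQ s_edge]; split=> // f.
apply: (@spherical_concyclic _ _ 0 1) (sQ f) _.
  by case=> [[|[|[|[|//]]]] ?]; apply: s1.
by apply: s_edge; left.
Qed.

End Spherical.

Lemma parallelC (R : realType) (m s : net R) : parallel m s -> parallel s m.
Proof.
move=> ms a b /ms; apply: contra.
by rewrite (perm_free (introT permPl (perm_catC [:: s a - s b] [:: m a - m b]))).
Qed.

Theorem corollary18 (R : realType) (m s : net R)
  (hcontact : contact_element_net m s)
  (hprincipal : principal m s)
  (hpoly : polyhedral_contact m s) :
  minimal m s <-> (isothermic s /\ christoffel_dual s m).
Proof.
have [[mQ _] ms [m_edge s_edge] m_area ms_faces] := hpoly.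
have s_polyhedral : polyhedral s.
  by split=> // f; have [nu [_ nus]] := ms_faces f; exists nu.
split=> [ms_min | [_ [_ _ _ dual]] f]; last first.
  have [nu [nus num A0]] := dual f; exists nu; split=> //.
  by rewrite /mean_curvature mixed_areaC A0 oppr0 mul0r.
have sm_dual : christoffel_dual s m.
  split=> // [|f]; first exact: parallelC.
  have [nu [num nus H0]] := ms_min f; exists nu; split=> //.
  have [nu' _ area_nu'] := m_area f.
  rewrite mixed_areaC; apply: mean_curvature0_mixed_area H0.
  exact: quad_area_neq0 area_nu'.
split=> //; split; first exact: spherical_circular.
by split=> //; exists m.
Qed.
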